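(* Let $n$ be a positive integer. Let $L_n$ be the graph with vertex set $\{r,v_n,v_{n-1},\dots,v_1\}\cup\{u_0,u_1,\dots,u_{2^{n+1}}\}$ whose edges are those of the path $r\,v_n\,v_{n-1}\cdots v_1$ (a path of length $n$) together with the edges $v_1u_i$ and $u_iu_0$ for every $i\in\{1,\dots,2^{n+1}\}$ (so $v_1$ and $u_0$ are joined by $2^{n+1}$ internally disjoint paths of length $2$). Root $L_n$ at $r$. Let $w$ be the weight function with $w(r)=0$, $w(v_j)=2^j$ for $j\in\{1,\dots,n\}$, and $w(u_i)=1$ for $i\in\{0,1,\dots,2^{n+1}\}$. Then $w$ is a valid weight function on $L_n$ rooted at $r$.
   Context: A configuration on a graph $G$ is a function $p:V(G)\to\mathbb{N}\cup\{0\}$ ($p(v)$ is the number of pebbles on $v$). A pebbling move from a vertex $u$ to an adjacent vertex $v$ removes two pebbles from $u$ and places one pebble on $v$. For a root $r$, a configuration $p$ is $r$-solvable if some (possibly empty) sequence of pebbling moves starting from $p$ places at least one pebble on $r$; otherwise it is $r$-unsolvable. A weight function is a function $w:V(G)\to\mathbb{R}_{\ge 0}$, and the weight of a configuration is $w(p)=\sum_{v\in V(G)}p(v)w(v)$. $1_G$ denotes the configuration with exactly one pebble on every vertex of $G$, so $w(1_G)=\sum_{v\in V(G)}w(v)$. A weight function $w$ on $G$ rooted at $r$ is valid if $r$ is the only vertex with weight $0$ and every $r$-unsolvable configuration $p$ satisfies $w(p)\le w(1_G)$. *)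

(* Defs.v *)
From Stdlib Require Import Relation_Operators.
From HB Require Import structures.
From mathcomp Require Import all_boot all_order all_algebra.
From mathcomp Require Import reals.

Set Implicit Arguments.
Unset Strict Implicit.
Unset Printing Implicit Defensive.

Import Order.TTheory GRing.Theory Num.Theory.
Local Open Scope ring_scope.

Record graph := Graph {
  vertex :> finType;
  adj : rel vertex;
  adj_sym : symmetric adj;
  adj_irr : irreflexive adj }.

Section Pebbling.

Variable G : graph.

Definition configuration := {ffun G -> nat}.

                                                                                 
Definition move_pebbles (p : configuration) (u v : G) : configuration :=
  [ffun x => p x - (if x == u then 2 else 0) + (if x == v then 1 else 0)]%N.

Definition pebbling_move (p q : configuration) : Prop :=
  exists u v : G, [/\ adj u v, (2 <= p u)%N & q = move_pebbles p u v].

Definition solvable (r : G) (p : configuration) : Prop :=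
  exists2 q : configuration,
    clos_refl_trans configuration pebbling_move p q & (1 <= q r)%N.

Definition unsolvable (r : G) (p : configuration) : Prop := ~ solvable r p.

Definition all_ones : configuration := [ffun=> 1%N].

Variable R : realType.

Definition weight (w : G -> R) (p : configuration) : R :=
  \sum_(v : G) (p v)%:R * w v.

Definition valid_weight (r : G) (w : G -> R) : Prop :=
  [/\ forall v : G, 0 <= w v,
      forall v : G, w v = 0 <-> v = r
    & forall p : configuration,
        unsolvable r p -> weight w p <= weight w all_ones].

End Pebbling.

                                                                            
                    
Inductive Lvertex (n : nat) : Type :=
  | Lr
  | Lv of 'I_n
  | Lu of 'I_(2 ^ n.+1).+1.

Arguments Lr {n}.
Arguments Lv {n} j.
Arguments Lu {n} i.

Section Lvertex_finType.

Variable n : nat.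

Definition Lvertex_enc (x : Lvertex n) : option ('I_n + 'I_(2 ^ n.+1).+1) :=
  match x with
  | Lr => None
  | Lv j => Some (inl j)
  | Lu i => Some (inr i)
  end.

Definition Lvertex_dec (s : option ('I_n + 'I_(2 ^ n.+1).+1)) : Lvertex n :=
  match s with
  | None => Lr
  | Some (inl j) => Lv j
  | Some (inr i) => Lu i
  end.

Lemma Lvertex_encK : cancel Lvertex_enc Lvertex_dec.
Proof. by case. Qed.

HB.instance Definition _ := Finite.copy (Lvertex n) (can_type Lvertex_encK).

End Lvertex_finType.

                                                                             
                 
Definition Ledge (n : nat) (x y : Lvertex n) : bool :=
  match x, y with
  | Lr, Lv j => j.+1 == n
  | Lv j, Lv k => j == k.+1 :> nat
  | Lv j, Lu i => (j == 0 :> nat) && (i != 0 :> nat)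
  | Lu i, Lu k => (i != 0 :> nat) && (k == 0 :> nat)
  | _, _ => false
  end%N.

Definition Ladj (n : nat) : rel (Lvertex n) :=
  fun x y => Ledge x y || Ledge y x.

Lemma Ladj_sym (n : nat) : symmetric (@Ladj n).
Proof. by move=> x y; rewrite /Ladj orbC. Qed.

Lemma Ladj_irr (n : nat) : irreflexive (@Ladj n).
Proof.
case=> [|j|i]; rewrite /Ladj orbb //=; first by rewrite ltn_eqF.
by case: eqP.
Qed.

Definition L (n : nat) : graph := Graph (@Ladj_sym n) (@Ladj_irr n).

Definition Lroot (n : nat) : L n := Lr.

Definition Lweight (R : realType) (n : nat) (x : L n) : R :=
  match x with
  | Lr => 0
  | Lv j => 2 ^+ j.+1
  | Lu _ => 1
  end.

(* Main.v *)
(** Pebbles on [v_1, ..., v_n] can be pushed towards [r] as long as some [v_j]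
    carries two of them, and such a push preserves [\sum_j 2^j p(v_j)]; hence
    the root is reached once this sum is at least [N := 2^(n+1)].  A pair of
    pebbles on some [u_i], [i > 0], adds one pebble on [v_1].  A pair on [u_0]
    first completes an odd [u_i] while there are any, and after that four
    pebbles of [u_0] are needed to bring one pebble to [v_1].  Let the
    potential be the value of the sum after all pebbles have been brought to
    [v_1] in this way.  Suppose that [p] has weight at least [2 N], that is, more
    than [w(1_G)].  If the [u_0]-pairs do not exhaust the [t <= N] odd [u_i],
    the potential is at least [2 N - t - 1 >= N - 1]; otherwise only pebbles of
    [u_0] lose value, by a factor of about two, and the potential is still more
    than [N - 2].  Being even, it is at least [N] in both cases. *)

Require Import Defs.
From mathcomp Require Import all_boot all_order all_algebra.
From mathcomp Require Import reals.
From mathcomp Require Import zify.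
From Stdlib Require Import Relation_Operators.

Set Implicit Arguments.
Unset Strict Implicit.
Unset Printing Implicit Defensive.

Import Order.TTheory GRing.Theory Num.Theory.

Section Moves.

Variable G : graph.
Implicit Types (p : configuration G) (u v : G).

(** Only the terms at [u] and [v] change. Old and new terms are added on opposite sides to avoid
    truncated subtraction; [f] will be the pebble count, [base_term] or [odd_term]. *)
Lemma sum_move_pebbles (f : G -> nat -> nat) p u v : adj u v ->
  \sum_x f x (move_pebbles p u v x) + (f u (p u) + f v (p v)) =
  \sum_x f x (p x) + (f u (p u - 2) + f v (p v).+1).
Proof.
move=> uv; have vNu : v != u by apply: contraTneq uv => ->; rewrite adj_irr.
rewrite [in LHS](bigD1 u) // [in RHS](bigD1 u) //=.
rewrite (bigD1 v) //= [in RHS](bigD1 v) //=.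
rewrite !ffunE !eqxx (negPf vNu) eq_sym (negPf vNu) addn0 subn0 addn1.
rewrite (eq_bigr (fun x => f x (p x))); last first.
  by move=> x /andP[/negPf xu /negPf xv]; rewrite ffunE xu xv subn0 addn0.
by lia.
Qed.

Lemma size_move_pebbles p u v : adj u v -> 2 <= p u ->
  \sum_x move_pebbles p u v x < \sum_x p x.
Proof. by move=> uv pu; have /= := sum_move_pebbles (fun=> id) p uv; lia. Qed.

Lemma solvable_move (r : G) p u v : adj u v -> 2 <= p u ->
  solvable r (move_pebbles p u v) -> solvable r p.
Proof.
move=> uv pu [q pq qr]; exists q => //; apply: rt_trans pq.
by apply: rt_step; exists u, v.
Qed.

End Moves.

Section Potential.

Variable n : nat.
Implicit Types (p : configuration (L n)) (x : L n).

Local Notation N := (2 ^ n.+1).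

Lemma eq_Lu i k : (Lu i == Lu k :> L n) = (i == k).
Proof. by apply/eqP/eqP => [[]|->]. Qed.

Lemma sum_L (F : L n -> nat) :
  \sum_x F x = F Lr + \sum_j F (Lv j) + \sum_i F (Lu i).
Proof.
rewrite (reindex (@Lvertex_dec n)) /=; last first.
  by exists (@Lvertex_enc n) => [[[]|]|[]].
rewrite (bigD1 None) //= -addnA; congr (_ + _).
rewrite (reindex_omap Some id) => [|[]] //=.
by under eq_bigl do rewrite eqxx; rewrite big_sumType.
Qed.

Lemma sum_expn2S m : \sum_(j < m) 2 ^ j.+1 = 2 ^ m.+1 - 2.
Proof.
elim: m => [|m IHm]; first by rewrite big_ord0.
by rewrite big_ord_recr /= IHm !expnS; have := expn_gt0 2 m; lia.
Qed.

(** A pebble doubles in value with each step along the path towards [r], hence the value [N] at the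
    root. A pair on [u_i], [i > 0], is worth 2, like the pebble on [v_1] that it buys; [u_0] is left
    to [gain]. *)
Definition base_term x (k : nat) : nat :=
  match x with
  | Lr => N * k
  | Lv j => 2 ^ j.+1 * k
  | Lu i => if i == ord0 then 0 else k./2.*2
  end.

Definition odd_term x (k : nat) : nat :=
  if x is Lu i then (i != ord0) && odd k else false.

(* Pebbles on [v_1] gained from [m] pairs on [u_0] when [t] of the other [u_i]
   are odd. *)
Definition gain (m t : nat) : nat := minn m t + (m - t)./2.

Definition base p := \sum_x base_term x (p x).
Definition odds p := \sum_x odd_term x (p x).
Definition potential p := base p + (gain (p (Lu ord0))./2 (odds p)).*2.

Lemma base_even p : ~~ odd (base p).
Proof.
apply: (big_ind (fun k => ~~ odd k)) => // [a b ha hb|[|j|i] _] /=.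
- by rewrite oddD (negPf ha) (negPf hb).
- by rewrite oddM oddX.
- by rewrite oddM oddX.
- by case: ifP; rewrite ?odd_double.
Qed.

Lemma odds_le p : odds p <= N.
Proof.
rewrite /odds sum_L /= big1 // add0n add0n big_ord_recl /= add0n.
by rewrite -[leqRHS]card_ord -sum1_card leq_sum // => i _; apply: leq_b1.
Qed.

(** These are the configurations where the strategy is stuck. At most one pair is left on [u_0], and
    with no odd [u_i] to complete it gains nothing; so the potential is at most that of one pebble
    on each [v_j], namely [N - 2]. *)
Lemma low_potential p : p Lr = 0 -> (forall j, p (Lv j) <= 1) ->
  (forall i, i != ord0 -> p (Lu i) <= 1) ->
  (2 <= p (Lu ord0) -> forall i, i != ord0 -> ~~ odd (p (Lu i))) ->
  p (Lu ord0) <= 3 -> potential p < N.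
Proof.
move=> pr pv pu no_odd p0.
have -> : potential p = base p.
  rewrite /potential /gain.
  have [p0_gt1|p0_le1] := ltnP 1 (p (Lu ord0)); last first.
    by rewrite (_ : _./2 = 0) ?min0n ?sub0n ?addn0 //; lia.
  have -> : odds p = 0; last by lia.
  rewrite /odds big1 // => -[|j|i] _ //=.
  by case: eqP => //= /eqP/(no_odd p0_gt1)/negPf->.
rewrite /base sum_L /base_term pr muln0 add0n.
rewrite [X in _ + X]big1 => [|i _]; last first.
  by case: ifPn => // /pu; lia.
rewrite addn0; apply: (@leq_ltn_trans (\sum_(j < n) 2 ^ j.+1)).
  by apply: leq_sum => j _; rewrite -[leqRHS]muln1 leq_mul.
by rewrite sum_expn2S; have := expn_gt0 2 n.+1; lia.
Qed.

Lemma base_odds_move p u v : Ladj u v ->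
  base (move_pebbles p u v) + (base_term u (p u) + base_term v (p v)) =
    base p + (base_term u (p u - 2) + base_term v (p v).+1)
  /\ odds (move_pebbles p u v) + (odd_term u (p u) + odd_term v (p v)) =
    odds p + (odd_term u (p u - 2) + odd_term v (p v).+1).
Proof. by move=> uv; split; apply: (@sum_move_pebbles (L n)). Qed.

Lemma potential_solvable p : 0 < n -> N <= potential p -> solvable (Lroot n) p.
Proof.
move=> n_gt0; have [k] := ubnP (\sum_x p x).
elim: k p => // k IHk p p_lt potp.
(* A move loses a pebble, so by induction it suffices to find a legal move that does not lower the
   potential. *)
have step u v : Ladj u v -> 2 <= p u ->
    potential p <= potential (move_pebbles p u v) -> solvable (Lroot n) p.
  move=> uv pu le_pot; apply: (@solvable_move (L n) _ _ u v) => //.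
  apply: IHk; last exact: leq_trans le_pot.
  by apply: leq_trans (@size_move_pebbles (L n) p u v uv pu) _.
have [pr|pr] := posnP (p Lr); last by exists p => //; apply: rt_refl.
have [/existsP[j pj]|/existsPn pv] := boolP [exists j, 2 <= p (Lv j)].
  (* The next vertex towards [r], worth twice as much per pebble; the last two clauses keep [odds]
     and the pile on [u_0] unchanged. *)
  have [v vj tv] : exists2 v, Ladj (Lv j) v &
      base_term v (p v).+1 = base_term v (p v) + 2 ^ j.+2 /\
      (forall m, odd_term v m = 0) /\ (v != Lu ord0).
    have [jn|jn] := eqVneq j.+1 n.
      exists Lr; first by rewrite /Ladj /= jn eqxx.
      by rewrite /= jn mulnS addnC.
    have lt_jn : j.+1 < n by rewrite ltn_neqAle jn ltn_ord.
    exists (Lv (Ordinal lt_jn)); first by rewrite /Ladj /= eqxx orbT.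
    by rewrite /= mulnS addnC.
  case: tv => [bv [ov vN0]]; apply: (step (Lv j) v) => //.
  have [] := base_odds_move p vj.
  rewrite /potential bv !ov /base_term /odd_term !addn0 => hb ->.
  rewrite ffunE /= eq_sym (negPf vN0) addn0 subn0.
  have : 2 ^ j.+1 * 2 <= 2 ^ j.+1 * p (Lv j) by rewrite leq_mul2l pj orbT.
  by move: hb; rewrite mulnBr [2 ^ j.+2]expnS; lia.
have [/existsP[i /andP[iN0 pi]]|/existsPn pu] :=
    boolP [exists i, (i != ord0) && (2 <= p (Lu i))].
  have iv : Ladj (Lu i) (Lv (Ordinal n_gt0)) by rewrite /Ladj /= iN0.
  apply: (step _ _ iv) => //.
  have [] := base_odds_move p iv.
  rewrite /potential /base_term /odd_term (negPf iN0).
  rewrite [2 ^ _](_ : _ = 2) // ffunE (eq_Lu ord0) eq_sym (negPf iN0).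
  by rewrite (_ : Lu _ == Lv _ = false) // addn0 subn0 /gain; lia.
(* If [u_i] is odd, [base] rises by 2 and [gain] drops by 1. If no odd vertex exists, [u_i] becomes
   one and a second pair on [u_0] is there to complete it, so [gain] is kept. *)
have to_u i : i != ord0 -> 2 <= p (Lu ord0) ->
    odd (p (Lu i)) || (p (Lu ord0) >= 4) && (odds p == 0) ->
    solvable (Lroot n) p.
  move=> iN0 p0 cond; have pi := pu i; rewrite iN0 /= -leqNgt in pi.
  have ui : Ladj (Lu ord0) (Lu i) by rewrite /Ladj /= andbT.
  apply: (step _ _ ui) => //.
  have [] := base_odds_move p ui.
  rewrite /potential /base_term /odd_term (negPf iN0) eqxx.
  rewrite ffunE !(eq_Lu ord0) [ord0 == i]eq_sym (negPf iN0) eqxx addn0 /gain.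
  by case/orP: cond => [|/andP[? /eqP]]; lia.
have pv1 j : p (Lv j) <= 1 by rewrite leqNgt pv.
have pu1 i : i != ord0 -> p (Lu i) <= 1.
  by move=> iN0; have := pu i; rewrite iN0 -leqNgt.
have [p0|p0] := ltnP 1 (p (Lu ord0)); last first.
  suff : potential p < N by rewrite ltnNge potp.
  by apply: low_potential => //; [rewrite ltnNge p0|exact: leq_trans p0 _].
have [/existsP[i /andP[iN0 oi]]|/existsPn no_odd] :=
    boolP [exists i, (i != ord0) && odd (p (Lu i))].
  by apply: (to_u i) => //; rewrite oi.
have [p04|p04] := ltnP 3 (p (Lu ord0)).
  (* All [u_i] with [i > 0] are now empty, so any of them serves; this is [u_1]. *)
  apply: (to_u (lift ord0 (Ordinal (expn_gt0 2 n.+1)))) => //.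
  rewrite p04 orbC /odds big1 // => -[|j|i] _ //=.
  by rewrite (negPf (no_odd i)).
suff : potential p < N by rewrite ltnNge potp.
by apply: low_potential => // _ i iN0; have := no_odd i; rewrite iN0.
Qed.

Definition nat_weight x : nat :=
  match x with Lr => 0 | Lv j => 2 ^ j.+1 | Lu _ => 1 end.

Lemma nat_weight_ones : \sum_x nat_weight x = N.*2.-1.
Proof.
rewrite sum_L /= sum_expn2S sum1_card card_ord expnS.
by have := expn_gt0 2 n; lia.
Qed.

(** Equality holds vertex by vertex except at [r], whose weight is 0. *)
Lemma nat_weight_le p :
  \sum_x p x * nat_weight x <= base p + odds p + p (Lu ord0).
Proof.
have -> : p (Lu ord0) = \sum_x (if x == Lu ord0 :> L n then p x else 0).
  by rewrite -big_mkcond big_pred1_eq.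
rewrite -!big_split; apply: leq_sum => -[|j|i] _ /=.
- by rewrite muln0.
- by rewrite mulnC addn0 leq_addr.
- by rewrite eq_Lu; case: eqP => /= _; lia.
Qed.

Lemma unsolvable_nat_weight p : 0 < n -> unsolvable (Lroot n) p ->
  \sum_x p x * nat_weight x <= \sum_x nat_weight x.
Proof.
move=> n_gt0 unsol; rewrite nat_weight_ones leqNgt; apply/negP => ltw.
apply: unsol; apply: potential_solvable => //.
have := nat_weight_le p; have := odds_le p; have := base_even p.
(* This makes [N] even, so that an even potential of at least [N - 1] is at least [N]. *)
have := expnS 2 n; have := expn_gt0 2 n.
by move: ltw; rewrite /potential /gain; lia.
Qed.

End Potential.

Local Open Scope ring_scope.

Lemma LweightE (R : realType) (n : nat) (x : L n) :
  Lweight R x = (nat_weight x)%:R.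
Proof. by case: x => //= j; rewrite natrX. Qed.

Theorem theorem3 (R : realType) (n : nat) (n_gt0 : (0 < n)%N) :
  valid_weight (Lroot n) (@Lweight R n).
Proof.
split=> [x|x|p unsol]; first by rewrite LweightE ler0n.
  rewrite LweightE; split=> [/eqP|-> //]; rewrite pnatr_eq0.
  by case: x => //= j; rewrite expn_eq0.
have weightE q : weight (@Lweight R n) q = (\sum_x q x * nat_weight x)%:R.
  by rewrite natr_sum; apply: eq_bigr => x _; rewrite LweightE natrM.
rewrite !weightE ler_nat.
under [leqRHS]eq_bigr do rewrite ffunE mul1n.
exact: unsolvable_nat_weight.
Qed.
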